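(* Let $S$ be a connected closed subset of $\mathbb{R}^k$ and let $\varphi$ be an i.i.d. random iteration of $J$-monotone continuous maps on $S$ (defined on $\Omega=E^{\mathbb{Z}}$, $\mathbb{P}=\nu^{\mathbb{Z}}$) satisfying the $J$-splitting condition. Then there is a measurable map $\pi\colon\Omega\to S$ such that for every $x\in S$ $$\lim_{n\to\infty} d(\varphi(n,\sigma^{-n}(\omega),x),\pi(\omega))=0$$ for $\mathbb{P}$-almost every $\omega$. Moreover, the distribution of $\pi$ is the unique stationary measure.
   Context: Setting. $(E,\nu)$ is a probability space, $\Omega=E^{\mathbb{Z}}$ with the product $\sigma$-algebra and the product measure $\mathbb{P}=\nu^{\mathbb{Z}}$; $\sigma\colon\Omega\to\Omega$ is the shift map $(\sigma(\omega))_i=\omega_{i+1}$. Let $S\subset\mathbb{R}^k$, let $f\colon E\times S\to S$ be measurable, and write $f_\alpha(x)=f(\alpha,x)$. The i.i.d. random iteration of maps $\varphi\colon\mathbb{N}\times\Omega\times S\to S$ is $$\varphi(n,\omega,x)=f_{\omega_{n-1}}\circ\cdots\circ f_{\omega_0}(x).$$ It is an i.i.d. random iteration of $J$-monotone continuous maps if every $f_\alpha\colon S\to S$ is continuous and $J$-monotone in the sense below. $d$ is the distance on $S\subset\mathbb{R}^k$. Order. Fix $J\subset\{1,\dots,k\}$. For $x,y\in\mathbb{R}^k$ write $x<_J y$ iff $x_i<y_i$ for all $i\in J$ and $x_i>y_i$ for all $i\notin J$. For subsets $S_1,S_2\subset\mathbb{R}^k$ write $S_1<_J S_2$ if $x<_J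 y$ for every $x\in S_1$, $y\in S_2$. A map $g\colon S\to S$ is $J$-increasing if $x<_J y\Rightarrow g(x)<_J g(y)$, $J$-decreasing if $x<_J y\Rightarrow g(y)<_J g(x)$, and $J$-monotone if it is either $J$-increasing or $J$-decreasing. $J$-splitting condition. $\varphi$ satisfies the $J$-splitting condition if there are $m\in\mathbb{N}$, $m\ge1$, and measurable subsets $A,B$ of $E^m$ with $\nu^m(A)>0$ and $\nu^m(B)>0$ such that for every $(\alpha_0,\dots,\alpha_{m-1})\in A$ and $(\beta_0,\dots,\beta_{m-1})\in B$, $$f_{\alpha_0}\circ\cdots\circ f_{\alpha_{m-1}}(S)<_J f_{\beta_0}\circ\cdots\circ f_{\beta_{m-1}}(S).$$ Stationary measure. A stationary measure is a Borel probability measure $\mu$ on $S$ with $\mu(A)=\int p(x,A)\,d\mu(x)$ for every Borel $A\subset S$, where $p(x,A)=\int\mathbf{1}_A(f_\alpha(x))\,d\nu(\alpha)$. The distribution of $\pi$ is the measure $A\mapsto\mathbb{P}(\pi^{-1}(A))$. *)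

(* Defs.v *)
From HB Require Import structures.
From mathcomp Require Import all_boot all_order all_algebra.
From mathcomp Require Import all_classical all_reals all_analysis.

Set Implicit Arguments.
Unset Strict Implicit.
Unset Printing Implicit Defensive.

Import Order.TTheory GRing.Theory Num.Theory.
Import numFieldNormedType.Exports.

Local Open Scope classical_set_scope.
Local Open Scope ring_scope.

(* [S] as a topological space in its own right (induced topology) with its
   Borel sigma-algebra.  [measurableType]s are pointed in the library, whence
   the proof that [S] is not empty. *)
Section state_space.
Context {X : topologicalType} {S : set X}.

Definition state (S0 : S !=set0) : Type := S.

Variable S0 : S !=set0.

HB.instance Definition _ := Topological.copy (state S0) S.

HB.instance Definition _ := isPointed.Build (state S0)
  (exist _ (sval (cid S0)) (mem_set (svalP (cid S0)))).

HB.instance Definition _ := @isMeasurable.Build (sigma_display (@open (state S0)))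
  (state S0) <<s @open (state S0) >> (@sigma_algebra0 _ _ _)
  (@sigma_algebraC (state S0) _) (@sigma_algebra_bigcup _ _ _).

Definition coords (x : state S0) : X := set_val (x : S).

End state_space.

Section order.
Context {R : realType} {k : nat}.
Implicit Types (J : {set 'I_k}) (x y : 'rV[R]_k).

Definition ltJ J x y : Prop :=
  (forall i, i \in J -> x ord0 i < y ord0 i) /\
  (forall i, i \notin J -> y ord0 i < x ord0 i).

Definition set_ltJ J (A B : set 'rV[R]_k) : Prop :=
  forall x y, A x -> B y -> ltJ J x y.

Definition euclid_dist x y : R := Num.sqrt (\sum_i (x ord0 i - y ord0 i) ^+ 2).

Context {S : set 'rV[R]_k} {S0 : S !=set0}.
Implicit Types g : state S0 -> state S0.

Definition J_increasing J g : Prop :=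
  forall x y : state S0, ltJ J (coords x) (coords y) -> ltJ J (coords (g x)) (coords (g y)).

Definition J_decreasing J g : Prop :=
  forall x y : state S0, ltJ J (coords x) (coords y) -> ltJ J (coords (g y)) (coords (g x)).

Definition J_monotone J g : Prop := J_increasing J g \/ J_decreasing J g.

End order.

Section bisequences.
Context {d : measure_display}.

Definition bisequence (E : measurableType d) :=
  g_sigma_algebraType (\bigcup_(i in [set: int])
    preimage_set_system setT (fun w : int -> E => w i) measurable).

Context {E : measurableType d}.

Definition bishift (w : bisequence E) : bisequence E := fun i => w (i + 1).

Definition bishift_inv (w : bisequence E) : bisequence E := fun i => w (i - 1).

Lemma bishiftK : cancel bishift bishift_inv.
Proof. by move=> w; apply/funext => i; rewrite /bishift_inv /bishift subrK. Qed.

Lemma bishift_invK : cancel bishift_inv bishift.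
Proof. by move=> w; apply/funext => i; rewrite /bishift_inv /bishift addrK. Qed.

(* Values on the finite-dimensional cylinders, a pi-system generating the
   sigma-algebra of [bisequence E], determine [P]. *)
Definition is_product_measure {R : realType} (nu : probability E R)
    (P : probability (bisequence E) R) : Prop :=
  forall (s : seq int) (A : int -> set E),
    uniq s -> (forall i, measurable (A i)) ->
    P [set w | forall i, i \in s -> A i (w i)] = (\prod_(i <- s) nu (A i))%E.

End bisequences.

Section finite_power.
Context {d : measure_display} {E : measurableType d} {R : realType}.

Definition tuple_cons n (p : E * n.-tuple E) : n.+1.-tuple E :=
  [tuple of p.1 :: p.2].

Lemma measurable_tuple_cons n : measurable_fun setT (@tuple_cons n).
Proof. exact: measurable_cons. Qed.

HB.instance Definition _ n :=
  isMeasurableFun.Build _ _ _ _ (@tuple_cons n) (@measurable_tuple_cons n).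

Fixpoint power_measure (nu : probability E R) m : probability (m.-tuple E) R :=
  match m with
  | 0 => \d_([tuple] : 0.-tuple E)
  | n.+1 => distribution (nu \x power_measure nu n)%E (@tuple_cons n)
  end.

Lemma power_measure_box (nu : probability E R) m (A : 'I_m -> set E) :
  (forall i, measurable (A i)) ->
  power_measure nu m [set t | forall i, A i (tnth t i)] =
    (\prod_(i < m) nu (A i))%E.
Proof.
elim: m A => [|m IH] A mA.
  rewrite big_ord0 /= diracE mem_set// => -[]//.
rewrite big_ord_recl -IH//= /distribution /pushforward.
rewrite (_ : _ @^-1` _ = A ord0 `*` [set t : m.-tuple E | forall i, A (lift ord0 i) (tnth t i)]).
  rewrite product_measure1E//.
  rewrite [X in measurable X](_ : _ = \bigcap_(i in [set: 'I_m])
      ((fun t => tnth t i) @^-1` A (lift ord0 i))); last first.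
    by apply/seteqP; split=> t /= h i; [move=> _|]; exact: h.
  apply: fin_bigcap_measurable => // i _; rewrite -[X in measurable X]setTI.
  exact: measurable_tnth.
apply/seteqP; split=> -[x t] /=.
  move=> h; split; first exact: (h ord0).
  by move=> i; have := h (lift ord0 i); rewrite tnthS.
move=> [h0 h1] i; case: (unliftP ord0 i) => [j|] -> //.
by rewrite tnthS.
Qed.

End finite_power.

Section random_iteration.
Context {d : measure_display} {E : measurableType d} {R : realType} {k : nat}.
Context {S : set 'rV[R]_k} {S0 : S !=set0}.
Variables (nu : probability E R) (J : {set 'I_k}).
Variable f : E -> state S0 -> state S0.

Fixpoint rand_iter (n : nat) (w : bisequence E) (x : state S0) : state S0 :=
  if n is n'.+1 then f (w n'%:Z) (rand_iter n' w x) else x.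

(* The image of S under f_{a_0} o ... o f_{a_(m-1)}, as a subset of R^k. *)
Definition word_image m (a : m.-tuple E) : set 'rV[R]_k :=
  range (fun x => coords (foldr f x a)).

Definition J_splitting : Prop :=
  exists m (A B : set (m.-tuple E)),
    [/\ (0 < m)%N, measurable A, measurable B,
        (0 < power_measure nu m A)%E & (0 < power_measure nu m B)%E] /\
    forall a b, A a -> B b -> set_ltJ J (word_image a) (word_image b).

Definition transition (x : state S0) (A : set (state S0)) : \bar R :=
  (\int[nu]_a (\1_A (f a x))%:E)%E.

Definition stationary (mu : probability (state S0) R) : Prop :=
  forall A, measurable A -> mu A = (\int[mu]_x transition x A)%E.

End random_iteration.

(* Main.v *)
Require Import Defs.
From HB Require Import structures.
From mathcomp Require Import all_boot all_order all_algebra.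
From mathcomp Require Import all_classical all_reals all_analysis.
From mathcomp Require Import measurable_realfun.
Import Order.TTheory GRing.Theory Num.Theory.
Import numFieldNormedType.Exports.
Local Open Scope classical_set_scope.
Local Open Scope ring_scope.
Set Implicit Arguments.
Unset Strict Implicit.
Unset Printing Implicit Defensive.

(** Read backwards in time, the iteration composes on the inside: for fixed
    [w] the map [pullback f n w : x |-> f_(w_-1) o ... o f_(w_-n) (x)] is
    followed by [pullback f n.+1 w = pullback f n w o f_(w_-(n+1))], so its
    images decrease with [n].  Everything follows from the fact that almost
    surely no coordinate of these images can, in the limit, surround a real
    number or reach infinity.

    The null sets.  Fix a coordinate [i] and a property [Q] of subsets of the
    line such that two sets lying strictly one below the other never both have
    it: for instance surrounding a given real [q] (having a point on each side
    of it), or being unbounded above or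
    below.  Let [g] be [J]-monotone, and append a
    block of [m] letters to it.  By splitting and monotonicity the images
    under [g] of all words of [A] lie on one side of the images under [g] of
    all words of [B], so [Q] cannot hold both for some word of [A] and for some
    word of [B]: [Q] fails on the whole of [A] or on the whole of [B]
    ([splitting_coord_image]).  Which of the two depends on [g], but in either
    case a block destroys [Q] with a probability bounded below, and this for
    every prefix [g].  Hence [Q] survives [n] blocks with probability at most
    [r ^ n], and it almost surely does not survive forever ([splitting_null]).
    The prefix is generalized in the induction, which only uses that putting an
    independent letter in front of the past preserves [P]
    ([prepend_invariance]).

    Convergence.  Applied to the three properties above, this says that the
    coordinates of [pullback f n w x] are almost surely bounded in [n] and,
    for every rational [q], that those of [pullback f n w x] and of
    [pullback f n w y] are not infinitely often on opposite sides of [q].  So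
    they converge, to a limit [p w] that does not depend on [x]
    ([pullback_limit]).

    Stationarity.  Passing to the limit in
    [pullback f n.+1 (prepend (a, w)) x = f a (pullback f n w x)] gives
    [p (prepend (a, w)) = f a (p w)] almost surely by continuity of [f a]; as
    [prepend] carries [nu \x P] to [P], the law of [p] is stationary
    ([limit_stationary]).

    Uniqueness.  A stationary [mu] is the law of [pullback f n w x] when [x]
    is drawn from [mu] independently of [w], for every [n].  Since these points
    converge to [p w], the law of [p] gives at most the mass [mu U] to each
    open [U] ([limit_open_le]).  Passing to complements and exhausting open
    sets by closed ones yields equality on open sets, hence everywhere. *)

(** * Topology and Borel sets of the state space *)

Section state_topology.
Context {R : realType} {k : nat} {S : set 'rV[R]_k} {S0 : S !=set0}.
Implicit Types (x y : state S0) (U : set (state S0)).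

Lemma coords_continuous : continuous (@coords _ S S0).
Proof. exact: initial_continuous. Qed.

Lemma coord_continuous_state i : continuous (fun x : state S0 => coords x ord0 i).
Proof.
move=> x; apply: (@continuous_comp _ _ _ (@coords _ S S0) (fun v : 'rV[R]_k => v ord0 i)).
  exact: coords_continuous.
exact: coord_continuous.
Qed.

Lemma open_state_measurable U : open U -> measurable U.
Proof. exact: sub_sigma_algebra. Qed.

Lemma measurable_coord i : measurable_fun setT (fun x : state S0 => coords x ord0 i).
Proof.
apply: (measurability _ (RGenOInfty.measurableE R)) => //.
move=> _ [_ [a ->] <-]; rewrite setTI; apply: open_state_measurable.
have /continuousP := @coord_continuous_state i; apply.
exact: interval_open.
Qed.

(** Convergence in [S] is tested on coordinates, where the order acts. *)
Lemma cvg_state (u : nat -> state S0) x :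
  (forall i, coords (u n) ord0 i @[n --> \oo] --> coords x ord0 i) ->
  u n @[n --> \oo] --> x.
Proof.
move=> ux U [_ [[B oB <-] Bx sBU]].
have /nbhs_ballP[e /= e0 eB] : nbhs (coords x) B by apply: open_nbhs_nbhs.
have : \forall n \near \oo, forall i, `|coords x ord0 i - coords (u n) ord0 i| < e.
  by apply: filter_forall => i; have /cvgrPdist_lt := ux i; exact.
apply: filterS => n xun; apply: sBU; apply: eB; split=> // i j.
by rewrite (ord1 i); exact: xun.
Qed.

Lemma cvg_coord (u : nat -> state S0) x (i : 'I_k) : u n @[n --> \oo] --> x ->
  coords (u n) ord0 i @[n --> \oo] --> coords x ord0 i.
Proof. by move=> ux; exact: (continuous_cvg _ (@coord_continuous_state i x) ux). Qed.

Lemma cvg_state_unique (u : nat -> state S0) x y :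
  u n @[n --> \oo] --> x -> u n @[n --> \oo] --> y -> x = y.
Proof.
move=> ux uy; apply: val_inj => /=; apply/rowP => i.
exact: (cvg_unique (@norm_hausdorff _ _) (cvg_coord ux) (cvg_coord uy)).
Qed.

Lemma cvgn_state (u : nat -> state S0) : closed S ->
  (forall i, cvgn (fun n => coords (u n) ord0 i)) -> exists z : state S0, u n @[n --> \oo] --> z.
Proof.
move=> cS uc; pose l : 'rV[R]_k := \row_i limn (fun n => coords (u n) ord0 i).
have Sl : S l.
  apply: cS => B /nbhs_ballP[e /= e0 eB].
  have : \forall n \near \oo, forall i, `|l ord0 i - coords (u n) ord0 i| < e.
    by apply: filter_forall => i; rewrite mxE; have /cvgrPdist_lt := uc i; exact.
  move=> /filter_ex[n un]; exists (coords (u n)); split.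
    by apply: set_mem; exact: (valP (u n : S)).
  by apply: eB; split=> // i j; rewrite (ord1 i); exact: un.
exists (exist _ l (mem_set Sl) : S); apply: cvg_state => i.
have -> : coords (exist _ l (mem_set Sl) : state S0) = l by [].
by rewrite mxE; exact: uc.
Qed.

Lemma euclid_dist_cvg0 (u : nat -> state S0) x : u n @[n --> \oo] --> x ->
  euclid_dist (coords (u n)) (coords x) @[n --> \oo] --> (0 : R).
Proof.
move=> ux; rewrite -(sqrtr0 R); apply: continuous_cvg; first exact: sqrt_continuous.
rewrite [X in _ --> X](_ : 0 = \sum_(i < k) (0 : R))%R; last by rewrite big1.
apply: cvg_big => [|i _]; first exact: add_continuous.
rewrite -[X in _ --> X](mulr0 (0 : R)).
under eq_cvg do rewrite expr2.
have ui : coords (u n) ord0 i - coords x ord0 i @[n --> \oo] --> (0 : R).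
  by rewrite -[X in _ --> X](subrr (coords x ord0 i)); apply: cvgB;
    [exact: cvg_coord|exact: cvg_cst].
exact: cvgM.
Qed.

(** Open sets are countable increasing unions of closed sets, and each of their
    points is even interior to one of these.  The last clause is what makes
    membership of a limit in [U] a statement about the tail of the sequence;
    exhaustion by closed sets is what compares two measures on open sets. *)
Lemma open_state_exhaustion U : open U ->
  exists C : nat -> set (state S0),
    [/\ forall n, closed (C n), nondecreasing_seq C, \bigcup_n C n = U &
        forall x, U x -> exists n, nbhs x (C n)].
Proof.
move=> [V oV <-].
(* The points at sup distance at least [1 / (n + 1)] from the complement of [V]. *)
pose C n : set (state S0) := [set x : state S0 | forall z, ~ V z ->
  exists i, n.+1%:R^-1 <= `|coords x ord0 i - z ord0 i|].
have CV n x : C n x -> V (coords x).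
  move=> Cx; apply: contrapT => nVx; have [i] := Cx _ nVx.
  by rewrite subrr normr0 leNgt invr_gt0 ltr0n.
have nC x : V (coords x) -> exists n, nbhs x (C n).
  move=> Vx; have /nbhs_ballP[e /= e0 eV] : nbhs (coords x) V by apply: open_nbhs_nbhs.
  have e20 : 0 < e / 2 by rewrite divr_gt0.
  have [n _ /(_ n (leqnn n)) /= ne] := near_infty_natSinv_lt (PosNum e20).
  exists n.
  have : nbhs x ((fun y => coords y) @^-1` (ball (coords x) (e / 2))).
    by apply: coords_continuous; exact: nbhsx_ballx.
  apply: filterS => y /= [_ xy] z nVz.
  apply: contrapT => /forallNP yz; apply: nVz; apply: eV; split=> // i j.
  rewrite (ord1 i); apply: (@ball_split _ _ (coords y ord0 j)).
    by have := xy ord0 j.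
  rewrite /ball /= ; have /negP := yz j; rewrite -ltNge => /lt_trans; exact.
exists C; split.
- move=> n; rewrite (_ : C n = \bigcap_(z in ~` V) ~` [set x : state S0 |
     forall i, `|coords x ord0 i - z ord0 i| < n.+1%:R^-1]).
    apply: closed_bigI => z _; apply: open_closedC.
    rewrite openE => x /= xz.
    suff : \forall y \near x, forall i,
      `|coords (y : state S0) ord0 i - z ord0 i| < n.+1%:R^-1 by [].
    apply: (@filter_forall _ _ _ _ (nbhs_filter x)) => i.
    have : continuous (fun x : state S0 => `|coords x ord0 i - z ord0 i|).
      move=> y; apply: (@continuous_comp _ _ _ (fun x : state S0 => coords x ord0 i)
        (fun r : R => `|r - z ord0 i|)); first exact: coord_continuous_state.
      by apply: cvg_norm; apply: cvgB; [exact: cvg_id|exact: cvg_cst].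
    by move=> /(_ x)/cvgr_lt; apply; exact: xz.
  apply/seteqP; split=> x Cx z nVz /=.
    have [i zi] := Cx _ nVz.
    by move=> /(_ i); rewrite ltNge zi.
  by have := Cx _ nVz; move=> /existsNP[i /negP]; rewrite -leNgt; exists i.
- move=> m n mn; apply/subsetPset => x Cx z nVz; have [i xz] := Cx _ nVz.
  by exists i; apply: le_trans xz; rewrite lef_pV2 ?posrE ?ltr0n// ler_nat ltnS.
- apply/seteqP; split=> [x [n _]|x Vx]; first exact: CV.
  by have [n /nbhs_singleton ?] := nC _ Vx; exists n.
- exact: nC.
Qed.

(** With [C] an exhaustion of [U] by closed sets, the limit lies in [U] if and
    only if, for some [j], the sequence is eventually in [C j]. *)
Lemma measurable_lim_state d (T : measurableType d) (h : nat -> T -> state S0)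
    (p : T -> state S0) :
  (forall n, measurable_fun setT (h n)) ->
  (forall w, h n w @[n --> \oo] --> p w) -> measurable_fun setT p.
Proof.
move=> mh hp; apply: (@measurability _ _ _ _ _ _ (@open (state S0))) => //.
move=> _ [U oU <-]; rewrite setTI.
have [C [cC ndC CU nC]] := open_state_exhaustion oU.
rewrite (_ : _ @^-1` _ = \bigcup_j \bigcup_N \bigcap_n (h (N + n)%N @^-1` C j)).
  apply: bigcupT_measurable => j; apply: bigcupT_measurable => N.
  apply: bigcapT_measurable => n; rewrite -[X in measurable X]setTI; apply: mh => //.
  by rewrite -[C j]setCK; apply: measurableC; apply: open_state_measurable; exact: closed_openC.
apply/seteqP; split=> w /=.
  move=> /nC[j /hp [N _ Nw]]; exists j => //; exists N => // n _.
  by apply: Nw; exact: leq_addr.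
move=> [j _ [N _ Cw]]; rewrite -CU; exists j => //.
apply: (closed_cvg (C j) (cC j) _ _ (hp w)); exists N => // n /= Nn.
by have := Cw (n - N)%N I; rewrite /= subnKC.
Qed.

End state_topology.

(** * Sections and null sets of product measures *)

Section sections.
Local Open Scope ereal_scope.
Context {d1 d2 : measure_display} {T1 : measurableType d1} {T2 : measurableType d2}
  {R : realType}.

Lemma xsection_set (D : set (T1 * T2)) x : xsection D x = [set y | D (x, y)].
Proof. by apply/seteqP; split=> y; rewrite /xsection /= inE. Qed.

Lemma ysection_set (D : set (T1 * T2)) y : ysection D y = [set x | D (x, y)].
Proof. by apply/seteqP; split=> x; rewrite /ysection /= inE. Qed.

Lemma measurable_fun_section_measure (m : probability T2 R) (D : set (T1 * T2)) :
  measurable D -> measurable_fun setT (fun x => m [set y | D (x, y)]).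
Proof.
move=> mD; apply: eq_measurable_fun (measurable_fun_xsection m mD) => x _ /=.
by rewrite xsection_set.
Qed.

Lemma section_measure_swap (m1 : probability T1 R) (m2 : probability T2 R)
    (D : set (T1 * T2)) : measurable D ->
  \int[m1]_x m2 [set y | D (x, y)] = \int[m2]_y m1 [set x | D (x, y)].
Proof.
move=> mD; have := indic_fubini_tonelli m1 m2 mD.
rewrite (indic_fubini_tonelli_FE m2 mD) (indic_fubini_tonelli_GE m1 mD) => h.
transitivity (\int[m1]_x (m2 \o xsection D) x).
  by apply: eq_integral => x _ /=; rewrite xsection_set.
by rewrite h; apply: eq_integral => y _ /=; rewrite ysection_set.
Qed.

Lemma eq_measure_off_null (m : probability T1 R) (A B N : set T1) :
  measurable A -> measurable B -> measurable N -> m N = 0 ->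
  (forall x, ~ N x -> A x <-> B x) -> m A = m B.
Proof.
move=> mA mB mN N0 AB; rewrite -(measureU0 mA mN N0) -(measureU0 mB mN N0).
congr (m _); apply/seteqP; split=> x [Ax|]; try by right.
- by have [Nx|/AB h] := pselect (N x); [right|left; apply/h].
- by have [Nx|/AB h] := pselect (N x); [right|left; apply/h].
Qed.

End sections.

(** * The product measure and independent first letters *)

Section product_measure.
Context {d : measure_display} {E : measurableType d} {R : realType}.
Variables (nu : probability E R).
Implicit Types (P Q : probability (bisequence E) R) (w : bisequence E).

Definition cylinder (s : seq int) (A : int -> set E) : set (bisequence E) :=
  [set w | forall i, i \in s -> A i (w i)].

Lemma measurable_letter i : measurable_fun setT (fun w : bisequence E => w i).
Proof.
move=> _ A mA; rewrite setTI; apply: sub_sigma_algebra.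
by exists i => //; exists A => //; rewrite setTI.
Qed.

Lemma measurable_fun_bisequence d' (T : measurableType d') (h : T -> bisequence E) :
  (forall i, measurable_fun setT (fun t => h t i)) -> measurable_fun setT h.
Proof.
move=> mh; pose G : set (set (bisequence E)) := \bigcup_(i in [set: int])
  preimage_set_system setT (fun w : int -> E => w i) measurable.
apply: (measurability G) => //.
move=> _ [_ [i _ [A mA <-]] <-]; rewrite !setTI.
by rewrite -[X in measurable X]setTI; apply: mh.
Qed.

Lemma measurable_cylinder s A : (forall i, measurable (A i)) -> measurable (cylinder s A).
Proof.
move=> mA; rewrite (_ : cylinder s A = \bigcap_(i in [set` s]) ((fun w => w i) @^-1` A i)).
  apply: fin_bigcap_measurable => // i _.
  by rewrite -[X in measurable X]setTI; apply: measurable_letter.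
by apply/seteqP; split=> w /= h i; exact: h.
Qed.

(** The cylinders form a pi-system that generates the sigma-algebra. *)
Lemma product_measure_unique P Q : is_product_measure nu P -> is_product_measure nu Q ->
  forall H, measurable H -> P H = Q H.
Proof.
move=> hP hQ.
pose G : set (set (bisequence E)) := [set C | exists s A,
  [/\ uniq s, forall i, measurable (A i) & C = cylinder s A]].
apply: (measure_unique G (fun=> setT)).
- apply/seteqP; split; last first.
    apply: smallest_sub; first exact: sigma_algebra_measurable.
    by move=> _ [s [A [_ mA ->]]]; exact: measurable_cylinder.
  apply: smallest_sub; first exact: smallest_sigma_algebra.
  move=> _ [i _ [A mA <-]]; apply: sub_sigma_algebra.
  exists [:: i], (fun=> A); split=> //; rewrite setTI.
  by apply/seteqP; split=> w /= => [Aw j|]; [rewrite inE => /eqP ->|apply; rewrite inE].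
- move=> _ _ [s [A [us mA ->]]] [t [B [ut mB ->]]].
  exists (undup (s ++ t)), (fun i => (if i \in s then A i else setT) `&`
    (if i \in t then B i else setT)); split; first exact: undup_uniq.
    by move=> i; apply: measurableI; case: ifP.
  apply/seteqP; split=> w /=.
    by move=> [As Bt] i _; split; [case: ifPn => [/As|]|case: ifPn => [/Bt|]].
  move=> h; split=> i hi; have := h i; rewrite mem_undup mem_cat hi ?orbT => /(_ erefl).
    by case.
  by case.
- by move=> _; exists [::], (fun=> setT); split=> //; apply/seteqP; split.
- by rewrite bigcup_const//; exists 0%N.
- by move=> _ [s [A [us mA ->]]]; exact: etrans (hP s A us mA) (esym (hQ s A us mA)).
- by move=> _; exact: fin_num_fun_lty (fin_num_measure P).
Qed.

(** The letter goes to position [-1], all others move down by one, and [w 0] is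
    overwritten.  Distinct positions still carry letters of distinct origin,
    whence the invariance of the product measure, and losing [w 0] is harmless
    because pullbacks read negative positions only. *)
Definition prepend (p : E * bisequence E) : bisequence E :=
  fun i => if i == -1 then p.1 else p.2 (i + 1).

Lemma measurable_prepend : measurable_fun setT prepend.
Proof.
apply: measurable_fun_bisequence => i; rewrite /prepend.
case: eqP => _; first exact: measurable_fst.
exact: (measurableT_comp (measurable_letter _) measurable_snd).
Qed.

HB.instance Definition _ :=
  isMeasurableFun.Build _ _ _ _ prepend measurable_prepend.

Lemma prepend_product P : is_product_measure nu P ->
  is_product_measure nu (distribution (nu \x P)%E prepend).
Proof.
move=> hP s A us mA.
rewrite [LHS](_ : _ = (nu \x P)%E (prepend @^-1` cylinder s A))//.
(* The preimage of a cylinder constrains [a] if [-1] is among the positions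
   and leaves it free otherwise; the other positions move up by one. *)
pose t := [seq i + 1 | i <- s & i != -1].
rewrite (_ : _ @^-1` _ = (if -1 \in s then A (-1) else setT) `*`
    cylinder t (fun i => A (i - 1))); last first.
  apply/seteqP; split=> -[a w] /=.
    move=> h; split.
      by case: ifPn => // /h; rewrite /prepend eqxx.
    move=> _ /mapP[i + ->]; rewrite mem_filter addrK => /andP[i1 /h].
    by rewrite /prepend (negbTE i1).
  move=> [h1 h2] i si; rewrite /prepend; case: eqP => [i1|/eqP i1] /=.
    by move: h1; rewrite -i1 si.
  have := h2 (i + 1); rewrite addrK; apply.
  by apply/mapP; exists i => //; rewrite mem_filter i1.
rewrite product_measure1E//; last 2 first.
- by case: ifP.
- exact: measurable_cylinder.
have Pt : P (cylinder t (fun i => A (i - 1))) = (\prod_(i <- t) nu (A (i - 1)%R))%E.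
  by apply: hP => //; rewrite map_inj_uniq ?filter_uniq//; exact: addIr.
rewrite [X in (_ * X)%E]Pt big_map big_filter.
under eq_bigr do rewrite addrK.
case: ifPn => s1.
  by rewrite [RHS](bigD1_seq (-1)).
rewrite [X in (X * _)%E](probability_setT nu) mul1e big_seq_cond [RHS]big_seq; apply: eq_bigl => i.
by case: eqP => [->|_]; rewrite ?andbT// (negbTE s1).
Qed.

(** The only form in which the product structure of [P] is used from here on. *)
Lemma prepend_invariance P H : is_product_measure nu P -> measurable H ->
  P H = (nu \x P)%E (prepend @^-1` H).
Proof.
move=> hP mH; exact: (product_measure_unique hP (prepend_product hP) mH).
Qed.

End product_measure.

Section prepend_word.
Context {d : measure_display} {E : measurableType d} {R : realType}.
Variables (nu : probability E R) (P : probability (bisequence E) R).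
Hypothesis hP : is_product_measure nu P.
Implicit Types H : set (bisequence E).
Local Open Scope ereal_scope.

Definition prepend_word (t : seq E) (w : bisequence E) : bisequence E :=
  foldr (fun a v => prepend (a, v)) w t.

Lemma prob_prepend H : measurable H ->
  P H = \int[nu]_a P [set w | H (prepend (a, w))].
Proof.
move=> mH; rewrite (prepend_invariance hP mH); apply: eq_integral => a _ /=.
by rewrite xsection_set.
Qed.

Lemma measurable_prepend_section H a : measurable H -> measurable [set w | H (prepend (a, w))].
Proof.
move=> mH; rewrite -(xsection_set (@prepend _ E @^-1` H)); apply: measurable_xsection.
by rewrite -[X in measurable X]setTI; exact: measurable_prepend.
Qed.

Lemma measurable_prepend_word_section H t : measurable H ->
  measurable [set w | H (prepend_word t w)].
Proof.
elim: t H => [//|a t IH] H mH.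
exact: (IH [set w | H (prepend (a, w))] (measurable_prepend_section a mH)).
Qed.

(** One step of the geometric decay: the conditional probability of [H] given
    the last [m] letters is at most [c], and it vanishes when these form a word
    of [A].  The induction on [m] splits off one letter at a time. *)
Lemma prob_prepend_word_le m (A : set (m.-tuple E)) H (c : R) :
  (0 <= c)%R -> measurable A -> measurable H ->
  (forall t : m.-tuple E, P [set w | H (prepend_word t w)] <= c%:E) ->
  (forall t : m.-tuple E, A t -> P [set w | H (prepend_word t w)] = 0) ->
  P H <= c%:E * power_measure nu m (~` A).
Proof.
move=> c0; elim: m A H => [|m IH] A H mA mH Hc HA.
  rewrite /= diracE; case: (pselect (A [tuple])) => A0.
    by rewrite (HA _ A0) mule_ge0// lee_fin.
  by rewrite mem_set// mule1; exact: (Hc [tuple]).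
rewrite (prob_prepend mH).
pose cA : set (E * m.-tuple E) := @tuple_cons _ E m @^-1` (~` A).
have mcA : measurable cA.
  rewrite -[X in measurable X]setTI; apply: measurable_tuple_cons => //.
  exact: measurableC.
have -> : power_measure nu m.+1 (~` A) = \int[nu]_a power_measure nu m (xsection cA a) by [].
have mX : measurable_fun setT (fun a => power_measure nu m (xsection cA a)).
  exact: measurable_fun_xsection.
rewrite -ge0_integralZl//.
apply: ge0_le_integral => //.
- apply: (measurable_fun_section_measure P (D := @prepend _ E @^-1` H)).
  by rewrite -[X in measurable X]setTI; exact: measurable_prepend.
- exact: measurable_funeM.
move=> a _ /=.
rewrite (_ : xsection _ _ = ~` [set t | A (tuple_cons (a, t))]); last first.
  by apply/seteqP; split=> w; rewrite /xsection /= inE.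
apply: IH.
- rewrite -[X in measurable X]setCK; apply: measurableC.
  rewrite (_ : ~` _ = xsection cA a); last first.
    by apply/seteqP; split=> w; rewrite /xsection /= inE.
  exact: measurable_xsection.
- exact: measurable_prepend_section.
- by move=> t; exact: (Hc (tuple_cons (a, t))).
- by move=> t At; exact: (HA (tuple_cons (a, t))).
Qed.

End prepend_word.

(** * Pullback iterates *)

Section pullback.
Context {d : measure_display} {E : measurableType d} {R : realType} {k : nat}.
Context {S : set 'rV[R]_k} {S0 : S !=set0}.
Variable f : E -> state S0 -> state S0.
Implicit Types (w : bisequence E) (x : state S0).

(** The iterates started [n] steps in the past, all observed at time [0]. *)
Definition pullback n w x := rand_iter f n (iter n bishift_inv w) x.

Lemma iter_bishift_inv n w i : iter n bishift_inv w i = w (i - n%:Z).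
Proof.
elim: n w i => [|n IH] w i /=; first by rewrite subr0.
by rewrite /bishift_inv IH -addrA -opprD -PoszD add1n.
Qed.

Lemma pullbackS n w x :
  pullback n.+1 w x = f (w (-1)) (pullback n (bishift_inv w) x).
Proof.
rewrite /pullback iterSr /= (_ : iter n bishift_inv (bishift_inv w) n = w (-1))//.
by rewrite -iterSr iter_bishift_inv -addn1 PoszD opprD addNKr.
Qed.

Lemma eq_pullback n w w' x : (forall i : nat, w (- i.+1%:Z) = w' (- i.+1%:Z)) ->
  pullback n w x = pullback n w' x.
Proof.
elim: n w w' => // n IH w w' ww'; rewrite !pullbackS (ww' 0%N); congr f.
by apply: IH => i; rewrite /bishift_inv -opprD -PoszD addn1 ww'.
Qed.

Lemma pullback_prepend n a w x :
  pullback n.+1 (prepend (a, w)) x = f a (pullback n w x).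
Proof.
rewrite pullbackS /prepend eqxx; congr f; apply: eq_pullback => i.
rewrite /bishift_inv subrK; by case: eqP.
Qed.

Lemma pullback_prepend_word n t w x :
  pullback (size t + n) (prepend_word t w) x = foldr f (pullback n w x) t.
Proof. by elim: t => //= a t IH; rewrite pullback_prepend IH. Qed.

End pullback.

(** * The splitting condition kills separating properties *)

Section splitting.
Context {d : measure_display} {E : measurableType d} {R : realType} {k : nat}.
Context {S : set 'rV[R]_k} {S0 : S !=set0}.
Variables (nu : probability E R) (P : probability (bisequence E) R) (J : {set 'I_k}).
Variable f : E -> state S0 -> state S0.
Hypothesis hP : is_product_measure nu P.
Hypothesis fJ : forall a, J_monotone J (f a).
Hypothesis splitting : J_splitting nu J f.
Implicit Types (g : state S0 -> state S0) (H : set (bisequence E)).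

Lemma J_monotone_comp g h : J_monotone J g -> J_monotone J h -> J_monotone J (g \o h).
Proof.
by move=> [gI|gD] [hI|hD]; [left|right|right|left] => x y xy /=;
  do ?[apply: gI|apply: gD]; do ?[apply: hI|apply: hD].
Qed.

Lemma J_monotone_word (t : seq E) : J_monotone J (fun x => foldr f x t).
Proof.
elim: t => [|a t IH] /=; first by left.
exact: (@J_monotone_comp (f a) (fun x => foldr f x t)).
Qed.

Definition coord_image (i : 'I_k) g : set R := range (fun x => coords (g x) ord0 i).

(** Splitting yields images lying strictly one below the other; a property of
    this kind is destroyed in one of them. *)
Definition separating (Q : set R -> Prop) :=
  forall T1 T2, (forall u v, T1 u -> T2 v -> u < v) -> ~ (Q T1 /\ Q T2).

(** The direction in which [g] orders the images of [A] and [B] is the same for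
    all words, so that one pair of words having [Q] would contradict
    separation; hence one of the two sets avoids [Q] altogether. *)
Lemma splitting_coord_image Q i g m (A B : set (m.-tuple E)) : separating Q ->
  (forall a b, A a -> B b -> set_ltJ J (word_image f a) (word_image f b)) ->
  J_monotone J g ->
  (forall a, A a -> ~ Q (coord_image i (fun x => g (foldr f x a)))) \/
  (forall b, B b -> ~ Q (coord_image i (fun x => g (foldr f x b)))).
Proof.
move=> Qsep AB gJ; apply: contrapT => /not_orP[/existsNP[a /not_implyP[Aa /contrapT Qa]]].
move=> /existsNP[b /not_implyP[Bb /contrapT Qb]].
have ab x y : ltJ J (coords (foldr f x a)) (coords (foldr f y b)).
  by apply: (AB _ _ Aa Bb); [exists x|exists y].
have ltab : (forall x y, coords (g (foldr f x a)) ord0 i < coords (g (foldr f y b)) ord0 i) \/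
   (forall x y, coords (g (foldr f y b)) ord0 i < coords (g (foldr f x a)) ord0 i).
  case: (boolP (i \in J)) => iJ; case: gJ => gM; [left|right|right|left] => x y;
  by have [gl gr] := gM _ _ (ab x y); first [exact: gl|exact: gr].
case: ltab => lt; [apply: (Qsep _ _ _ (conj Qa Qb))|apply: (Qsep _ _ _ (conj Qb Qa))].
  by move=> _ _ [x _ <-] [y _ <-]; exact: lt.
by move=> _ _ [x _ <-] [y _ <-]; exact: lt.
Qed.

Lemma splitting_rate : exists m (A B : set (m.-tuple E)) (r : R),
  [/\ measurable A, measurable B,
      forall a b, A a -> B b -> set_ltJ J (word_image f a) (word_image f b) &
      [/\ 0 <= r, r < 1, (power_measure nu m (~` A) <= r%:E)%E &
        (power_measure nu m (~` B) <= r%:E)%E]].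
Proof.
have [m [A [B [[_ mA mB A0 B0] AB]]]] := splitting.
have compl (C : set (m.-tuple E)) : measurable C -> (0 < power_measure nu m C)%E ->
    exists r, [/\ 0 <= r, r < 1 & (power_measure nu m (~` C) <= r%:E)%E].
  move=> mC C0; exists (fine (power_measure nu m (~` C))).
  have fC : power_measure nu m C \is a fin_num by exact: fin_num_measure.
  have fCC : power_measure nu m (~` C) \is a fin_num.
    by apply: fin_num_measure; exact: measurableC.
  split; [exact: fine_ge0| |by rewrite fineK].
  rewrite -lte_fin fineK// probability_setC// -(fineK fC) -EFinB lte_fin.
  by rewrite ltrBlDr ltrDl -lte_fin fineK.
have [r [r0 r1 Ar]] := compl A mA A0; have [s [s0 s1 Bs]] := compl B mB B0.
exists m, A, B, (Num.max r s); split=> //; split.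
- by rewrite le_max r0.
- by rewrite gt_max r1.
- by rewrite (le_trans Ar)// lee_fin le_max lexx.
- by rewrite (le_trans Bs)// lee_fin le_max lexx orbT.
Qed.

(** Each block of [m] letters falls with probability at least [1 - r] in the one
    of [A], [B] that destroys [Q].  The statement [decay] ranges over all
    monotone prefixes [g], because conditioning on the first block replaces [g]
    by its composition with this block. *)
Lemma splitting_null Q i H : separating Q -> measurable H ->
  (forall w, H w -> forall n, Q (coord_image i (pullback f n w))) -> P H = 0%E.
Proof.
move=> Qsep mH HQ.
have [m [A [B [r [mA mB AB [r0 r1 Ar Br]]]]]] := splitting_rate.
have decay n : forall g H, J_monotone J g -> measurable H ->
    (forall w, H w -> forall n, Q (coord_image i (g \o pullback f n w))) ->
    (P H <= (r ^+ n)%:E)%E.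
  elim: n => [|n IH] g {}H gJ {}mH {}HQ; first by rewrite expr0 probability_le1.
  have step (C : set (m.-tuple E)) : measurable C ->
      (power_measure nu m (~` C) <= r%:E)%E ->
      (forall c, C c -> ~ Q (coord_image i (fun x => g (foldr f x c)))) ->
      (P H <= (r ^+ n.+1)%:E)%E.
    move=> mC Cr nQ; rewrite exprSr EFinM.
    have c0 : 0 <= r ^+ n by exact: exprn_ge0.
    apply: (@le_trans _ _ ((r ^+ n)%:E * power_measure nu m (~` C))%E); last first.
      by rewrite lee_wpmul2l// lee_fin.
    apply: prob_prepend_word_le => // t; last first.
      move=> Ct; rewrite (_ : mkset _ = set0) ?measure0//.
      apply/seteqP; split=> // w /= /HQ/(_ (size t + 0)%N) Qt; apply: (nQ _ Ct); move: Qt.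
      by congr (Q (coord_image _ _)); apply/funext => x /=; rewrite pullback_prepend_word.
    apply: (IH (fun x => g (foldr f x t))).
    - by apply: J_monotone_comp => //; exact: J_monotone_word.
    - exact: measurable_prepend_word_section.
    move=> w /= /HQ Hw N; have := Hw (size t + N)%N.
    by congr (Q (coord_image _ _)); apply/funext => x /=; rewrite pullback_prepend_word.
  by have [|] := splitting_coord_image i Qsep AB gJ; exact: step.
have fP : P H \is a fin_num by exact: fin_num_measure.
apply/eqP; rewrite eq_le measure_ge0 andbT -(fineK fP) lee_fin.
have rn : r ^+ n @[n --> \oo] --> (0 : R) by apply: cvg_expr; rewrite ger0_norm.
apply: (cvgr_to_ge rn); near=> n; rewrite -lee_fin fineK//.
by apply: (decay n id) => //; left.
Unshelve. all: by end_near.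
Qed.

End splitting.

(** * Real sequences that do not cross rationals *)

Section real_sequences.
Context {R : realType}.
Implicit Types (u v : nat -> R) (p : nat -> Prop).

Definition infinitely_often p : Prop := forall N, exists n, p (N + n)%N.

Lemma not_infinitely_often p : ~ infinitely_often p -> \forall n \near \oo, ~ p n.
Proof.
move=> /existsNP[N /forallNP Np]; exists N => // n /= Nn.
by have := Np (n - N)%N; rewrite subnKC.
Qed.

Lemma near_infinitely_often p : (\forall n \near \oo, p n) -> infinitely_often p.
Proof. by move=> [N _ Np] M; exists N; apply: Np; exact: leq_addl. Qed.

(** Indexing by [nat] lets the null sets of all rationals be merged at once. *)
Definition enum_rat n : R := ratr (odflt 0 (@unpickle rat n)).

Lemma enum_rat_dense (a b : R) : a < b -> exists n, a < enum_rat n < b.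
Proof.
move=> /rat_in_itvoo[q]; rewrite in_itv /= => aqb.
by exists (pickle q); rewrite /enum_rat pickleK.
Qed.

Definition crossing u v (q : R) : Prop :=
  infinitely_often (fun n => u n <= q) /\ infinitely_often (fun n => q <= v n).

(** If [u] did not converge to [l], it would be infinitely often beyond some
    rational close to [l], while [v] eventually is on the other side. *)
Lemma cvg_not_crossing u v (l : R) : v n @[n --> \oo] --> l ->
  (forall j, ~ crossing u v (enum_rat j)) -> (forall j, ~ crossing v u (enum_rat j)) ->
  u n @[n --> \oo] --> l.
Proof.
move=> vl uv vu; apply/cvgrPdist_lt => e e0.
have [j /andP[j1 j2]] : exists j, l - e < enum_rat j < l.
  by apply: enum_rat_dense; rewrite ltrBlDr ltrDl.
have [i /andP[i1 i2]] : exists i, l < enum_rat i < l + e.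
  by apply: enum_rat_dense; rewrite ltrDl.
have ju : \forall n \near \oo, ~ (u n <= enum_rat j).
  apply: not_infinitely_often => h; apply: (uv j); split=> //; apply: near_infinitely_often.
  exact: (cvgr_ge l).
have ui : \forall n \near \oo, ~ (enum_rat i <= u n).
  apply: not_infinitely_often => h; apply: (vu i); split=> //; apply: near_infinitely_often.
  exact: (cvgr_le l).
near=> n; rewrite ltr_distlC; apply/andP; split.
  rewrite (lt_trans j1)// ltNge; apply/negP; near: n; exact: ju.
rewrite (lt_trans _ i2)// ltNge; apply/negP; near: n; exact: ui.
Unshelve. all: by end_near.
Qed.

(** A bounded sequence that does not oscillate around any rational converges:
    its lower and upper limits cannot be separated by a rational. *)
Lemma cvg_not_self_crossing u :
  (exists K : nat, ~ infinitely_often (fun n => K%:R <= u n)) ->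
  (exists K : nat, ~ infinitely_often (fun n => u n <= - K%:R)) ->
  (forall j, ~ crossing u u (enum_rat j)) -> cvgn u.
Proof.
move=> [K /not_infinitely_often uK] [L /not_infinitely_often Lu] uu.
(* The supremum of [A] is the lower limit of [u]. *)
pose A : set R := [set r | \forall n \near \oo, r < u n].
have A0 : A (- L%:R).
  by apply: filterS Lu => n /negP; rewrite -ltNge.
have AK : ubound A K%:R.
  move=> r Ar; have [n [/= rn /negP]] := filter_ex (filterI Ar uK).
  by rewrite -ltNge => nK; apply: ltW; exact: lt_trans nK.
have sA : has_sup A by split; [exists (- L%:R)|exists K%:R].
apply/cvg_ex; exists (sup A); apply/cvgrPdist_lt => e e0.
have [r Ar lr] := sup_adherent e0 sA.
have [i /andP[i1 i2]] : exists i, sup A < enum_rat i < sup A + e.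
  by apply: enum_rat_dense; rewrite ltrDl.
have ui : \forall n \near \oo, ~ (enum_rat i <= u n).
  apply: not_infinitely_often => h; apply: (uu i); split=> //.
  apply: contrapT => /not_infinitely_often ih.
  have : A (enum_rat i) by apply: filterS ih => n /negP; rewrite -ltNge.
  by move=> /(sup_upper_bound sA); rewrite leNgt i1.
near=> n; rewrite ltr_distlC; apply/andP; split.
  by rewrite (lt_trans lr)//; near: n; exact: Ar.
rewrite (lt_trans _ i2)// ltNge; apply/negP; near: n; exact: ui.
Unshelve. all: by end_near.
Qed.

End real_sequences.

(** * Almost sure convergence of the pullback iterates *)

Section convergence.
Context {d : measure_display} {E : measurableType d} {R : realType} {k : nat}.
Context {S : set 'rV[R]_k} {S0 : S !=set0}.
Variables (nu : probability E R) (P : probability (bisequence E) R) (J : {set 'I_k}).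
Variable f : E -> state S0 -> state S0.
Hypothesis hP : is_product_measure nu P.
Hypothesis mf : measurable_fun setT (fun p : E * state S0 => f p.1 p.2).
Implicit Types (w : bisequence E) (x y : state S0).

Lemma measurable_bishift_inv : measurable_fun setT (@bishift_inv _ E).
Proof. by apply: measurable_fun_bisequence => i; exact: measurable_letter. Qed.

Lemma measurable_pullback2 n :
  measurable_fun setT (fun p : bisequence E * state S0 => pullback f n p.1 p.2).
Proof.
elim: n => [|n IH]; first exact: measurable_snd.
apply: (@eq_measurable_fun _ _ _ _ _ ((fun p : E * state S0 => f p.1 p.2) \o
    (fun p : bisequence E * state S0 => (p.1 (-1), pullback f n (bishift_inv p.1) p.2)))).
  by move=> p _; rewrite /= pullbackS.
apply: measurableT_comp mf _.
apply: measurable_fun_pair.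
  exact: (measurableT_comp (measurable_letter _) measurable_fst).
apply: (measurableT_comp IH (g := fun p : bisequence E * state S0 => (bishift_inv p.1, p.2))).
apply: measurable_fun_pair => //.
exact: (measurableT_comp measurable_bishift_inv measurable_fst).
Qed.

Lemma measurable_pullback n x : measurable_fun setT (fun w => pullback f n w x).
Proof.
apply: (measurableT_comp (measurable_pullback2 n) (g := fun w => (w, x))).
exact: measurable_fun_pair.
Qed.

Lemma measurable_pullback_coord n x i :
  measurable_fun setT (fun w => coords (pullback f n w x) ord0 i).
Proof. exact: (measurableT_comp (measurable_coord i) (measurable_pullback n x)). Qed.

(** Later iterates stay in the images of earlier ones, so that what happens
    infinitely often along an orbit is seen in all the images. *)
Lemma pullback_coord_image n m w x i :
  coord_image i (pullback f n w) (coords (pullback f (n + m) w x) ord0 i).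
Proof.
suff [y ->] : exists y, pullback f (n + m) w x = pullback f n w y by exists y.
elim: n w => [|n IH] w; first by exists (pullback f m w x).
by have [y e] := IH (bishift_inv w); exists y; rewrite addSn !pullbackS e.
Qed.

Lemma measurable_infinitely_often (A : nat -> set (bisequence E)) : (forall n, measurable (A n)) ->
  measurable [set w | infinitely_often (fun n => A n w)].
Proof.
move=> mA; rewrite (_ : mkset _ = \bigcap_N \bigcup_n A (N + n)%N).
  by apply: bigcapT_measurable => N; apply: bigcupT_measurable => n.
apply/seteqP; split=> w /= h N.
  by move=> _; have [n ?] := h N; exists n.
by have [n _ ?] := h N I; exists n.
Qed.

Lemma measurable_coord_le n x i q : measurable [set w | coords (pullback f n w x) ord0 i <= q].
Proof.
have := measurable_pullback_coord n x i measurableT (measurable_itv `]-oo, q]).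
by rewrite setTI; congr measurable; apply/seteqP; split=> w; rewrite /= in_itv.
Qed.

Lemma measurable_coord_ge n x i q : measurable [set w | q <= coords (pullback f n w x) ord0 i].
Proof.
have := measurable_pullback_coord n x i measurableT (measurable_itv `[q, +oo[).
by rewrite setTI; congr measurable; apply/seteqP; split=> w; rewrite /= in_itv /= andbT.
Qed.

Hypothesis fJ : forall a, J_monotone J (f a).
Hypothesis splitting : J_splitting nu J f.

Lemma ae_not_crossing x y i : {ae P, forall w, forall j,
  ~ crossing (fun n => coords (pullback f n w x) ord0 i)
      (fun n => coords (pullback f n w y) ord0 i) (enum_rat j)}.
Proof.
apply: ae_foralln => j; set q : R := enum_rat j.
exists [set w | infinitely_often (fun n => coords (pullback f n w x) ord0 i <= q)
   /\ infinitely_often (fun n => q <= coords (pullback f n w y) ord0 i)].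
have mH : measurable [set w | infinitely_often (fun n => coords (pullback f n w x) ord0 i <= q)
   /\ infinitely_often (fun n => q <= coords (pullback f n w y) ord0 i)].
  apply: measurableI; apply: measurable_infinitely_often => n; first exact: measurable_coord_le.
  exact: measurable_coord_ge.
split=> //; last by move=> w /= /contrapT.
apply: (splitting_null hP fJ splitting
    (Q := fun T => exists u v, [/\ T u, T v, u <= q & q <= v])) => //.
  move=> T1 T2 T12 [[u [v [_ Tv _ qv]]] [u' [v' [Tu _ uq _]]]].
  by have := T12 _ _ Tv Tu; rewrite ltNge (le_trans uq).
move=> w [xq qy] n; have [m1 h1] := xq n; have [m2 h2] := qy n.
eexists; eexists; split; [| |exact: h1|exact: h2]; exact: pullback_coord_image.
Qed.

Lemma ae_bounded_above x i : {ae P, forall w, exists K : nat,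
  ~ infinitely_often (fun n => K%:R <= coords (pullback f n w x) ord0 i)}.
Proof.
exists (\bigcap_(K : nat)
  [set w | infinitely_often (fun n => K%:R <= coords (pullback f n w x) ord0 i)]).
have mH : measurable (\bigcap_(K : nat)
    [set w | infinitely_often (fun n => K%:R <= coords (pullback f n w x) ord0 i)]).
  by apply: bigcapT_measurable => K; apply: measurable_infinitely_often => n;
    exact: measurable_coord_ge.
split=> //; last by move=> w /= /forallNP h K _; apply: contrapT; exact: h.
apply: (splitting_null hP fJ splitting
    (Q := fun T => forall K : nat, exists2 u, T u & K%:R <= u)) => //.
  move=> T1 T2 T12 [T1K T2K]; have [v Tv _] := T2K 0%N.
  have [u Tu uv] := T1K (Num.truncn v).+1.
  by have := T12 _ _ Tu Tv; rewrite ltNge (le_trans _ uv)// ltW// truncnS_gt.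
move=> w hw n K; have [m h] := hw K I n.
by eexists; [|exact: h]; exact: pullback_coord_image.
Qed.

Lemma ae_bounded_below x i : {ae P, forall w, exists K : nat,
  ~ infinitely_often (fun n => coords (pullback f n w x) ord0 i <= - K%:R)}.
Proof.
exists (\bigcap_(K : nat)
  [set w | infinitely_often (fun n => coords (pullback f n w x) ord0 i <= - K%:R)]).
have mH : measurable (\bigcap_(K : nat)
    [set w | infinitely_often (fun n => coords (pullback f n w x) ord0 i <= - K%:R)]).
  by apply: bigcapT_measurable => K; apply: measurable_infinitely_often => n;
    exact: measurable_coord_le.
split=> //; last by move=> w /= /forallNP h K _; apply: contrapT; exact: h.
apply: (splitting_null hP fJ splitting
    (Q := fun T => forall K : nat, exists2 u, T u & u <= - K%:R)) => //.
  move=> T1 T2 T12 [T1K T2K]; have [v Tv _] := T1K 0%N.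
  have [u Tu uv] := T2K (Num.truncn (- v)).+1.
  by have := T12 _ _ Tv Tu; rewrite ltNge (le_trans uv)// lerNl ltW// truncnS_gt.
move=> w hw n K; have [m h] := hw K I n.
by eexists; [|exact: h]; exact: pullback_coord_image.
Qed.

Lemma ae_cvg_coord x i :
  {ae P, forall w, cvgn (fun n => coords (pullback f n w x) ord0 i)}.
Proof.
have h1 := ae_bounded_above x i; have h2 := ae_bounded_below x i.
have h3 := ae_not_crossing x x i.
by apply: filterS3 h1 h2 h3 => w; exact: cvg_not_self_crossing.
Qed.

End convergence.

Section limit.
Context {d : measure_display} {E : measurableType d} {R : realType} {k : nat}.
Context {S : set 'rV[R]_k} {S0 : S !=set0}.
Variables (nu : probability E R) (P : probability (bisequence E) R) (J : {set 'I_k}).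
Variable f : E -> state S0 -> state S0.
Hypothesis hP : is_product_measure nu P.
Hypothesis cS : closed S.
Hypothesis mf : measurable_fun setT (fun p : E * state S0 => f p.1 p.2).
Hypothesis fJ : forall a, J_monotone J (f a).
Hypothesis splitting : J_splitting nu J f.
Implicit Types (w : bisequence E) (x y : state S0).

(** The limit is taken along the orbit of one base point, after replacing the
    orbit by a constant on a measurable null set outside which it converges;
    this makes the limit defined and measurable everywhere. *)
Lemma pullback_limit : exists p : {mfun bisequence E >-> state S0}, forall x,
   {ae P, forall w, pullback f n w x @[n --> \oo] --> p w}.
Proof.
pose x0 : state S0 := point.
have [N [mN N0 sN]] : {ae P, forall w, forall i,
    cvgn (fun n => coords (pullback f n w x0) ord0 i)}.
  by apply: filter_forall => i; exact: (ae_cvg_coord hP mf fJ splitting x0 i).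
have good w : ~ N w -> exists z : state S0, pullback f n w x0 @[n --> \oo] --> z.
  by move=> Nw; apply: cvgn_state cS _; apply: contrapT => h; apply: Nw; exact: sN.
pose h n w := if w \in N then x0 else pullback f n w x0.
have mh n : measurable_fun setT (h n).
  apply: measurable_fun_ifT => //; last exact: measurable_pullback.
  apply: (measurable_fun_bool true).
  by rewrite setTI (_ : _ @^-1` _ = N)//; apply/seteqP; split=> w; [exact: set_mem|exact: mem_set].
have hc w : exists z : state S0, h n w @[n --> \oo] --> z.
  have [Nw|Nw] := pselect (N w).
    by exists x0; rewrite /h mem_set//; exact: cvg_cst.
  have [z wz] := good w Nw; exists z.
  by rewrite /h memNset.
have /choice[p hp] := hc.
have mp : measurable_fun setT p by exact: measurable_lim_state hp.
exists (mfun_Sub (mem_set mp)).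
have px0 : {ae P, forall w, pullback f n w x0 @[n --> \oo] --> p w}.
  exists N; split=> // w /= nw; apply: contrapT => Nw; apply: nw.
  by have := hp w; rewrite /h memNset.
move=> x.
have h1 : {ae P, forall w, forall i j, ~ crossing (fun n => coords (pullback f n w x) ord0 i)
      (fun n => coords (pullback f n w x0) ord0 i) (enum_rat j)}.
  by apply: filter_forall => i; exact: (ae_not_crossing hP mf fJ splitting).
have h2 : {ae P, forall w, forall i j, ~ crossing (fun n => coords (pullback f n w x0) ord0 i)
      (fun n => coords (pullback f n w x) ord0 i) (enum_rat j)}.
  by apply: filter_forall => i; exact: (ae_not_crossing hP mf fJ splitting).
apply: filterS3 px0 h1 h2 => w wp w1 w2; apply: cvg_state => i.
by apply: cvg_not_crossing (w1 i) (w2 i); exact: cvg_coord.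
Qed.

End limit.

(** * The law of the limit is the unique stationary measure *)

Section stationarity.
Context {d : measure_display} {E : measurableType d} {R : realType} {k : nat}.
Context {S : set 'rV[R]_k} {S0 : S !=set0}.
Variables (nu : probability E R) (P : probability (bisequence E) R).
Variable f : E -> state S0 -> state S0.
Hypothesis hP : is_product_measure nu P.
Hypothesis mf : measurable_fun setT (fun p : E * state S0 => f p.1 p.2).
Hypothesis fc : forall a, continuous (f a).
Variable p : {mfun bisequence E >-> state S0}.
Hypothesis plim : forall x, {ae P, forall w, pullback f n w x @[n --> \oo] --> p w}.
Local Open Scope ereal_scope.

Lemma measurable_step_set d' (T : measurableType d') (a : T -> E) (y : T -> state S0) A :
  measurable_fun setT a -> measurable_fun setT y -> measurable A ->
  measurable [set t | A (f (a t) (y t))].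
Proof.
move=> ma my mA; rewrite -[X in measurable X]setTI.
exact: (measurableT_comp mf (measurable_fun_pair ma my) measurableT mA).
Qed.

Lemma transitionE x A : measurable A -> transition nu f x A = nu [set a | A (f a x)].
Proof.
move=> mA; have mfx : measurable [set a | A (f a x)].
  exact: measurable_step_set.
by rewrite /transition -[in RHS](setIT (mkset _)) -integral_indic//.
Qed.

Lemma measurable_transition A : measurable A -> measurable_fun setT (fun x => transition nu f x A).
Proof.
move=> mA; have mD : measurable [set q : state S0 * E | A (f q.2 q.1)].
  exact: (measurable_step_set measurable_snd measurable_fst).
apply: eq_measurable_fun (measurable_fun_section_measure nu mD) => x _ /=.
by rewrite transitionE.
Qed.

(** The exceptional set must be null for the product: it consists of the pairs
    for which the iterates of [w] or those of [prepend (a, w)] do not converge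
    to [p], and the latter is null because [prepend] preserves [P]. *)
Lemma limit_equivariant : exists N : set (E * bisequence E),
  [/\ measurable N, (nu \x P) N = 0 &
    forall a w, ~ N (a, w) -> p (prepend (a, w)) = f a (p w)].
Proof.
have [N [mN N0 sN]] := plim point.
have cN w : ~ N w -> pullback f n w point @[n --> \oo] --> p w.
  by move=> Nw; apply: contrapT => h; apply: Nw; exact: sN.
have mpN : measurable (@prepend _ E @^-1` N).
  by rewrite -[X in measurable X]setTI; exact: measurable_prepend.
have mTN : measurable ([set: E] `*` N) by exact: measurableX.
exists (@prepend _ E @^-1` N `|` [set: E] `*` N); split.
- exact: measurableU.
- rewrite measureU0//; first exact: etrans (esym (prepend_invariance hP mN)) N0.
  by apply: (etrans (product_measure1E nu P measurableT mN)); rewrite [X in _ * X]N0 mule0.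
move=> a w /not_orP[/= N1 /not_andP[//|N2]].
have c1 := cN _ N1; have c2 := cN _ N2.
have : pullback f n.+1 (prepend (a, w)) point @[n --> \oo] --> f a (p w).
  rewrite (_ : (fun n => _) = f a \o (fun n => pullback f n w point)).
    by apply: continuous_cvg c2; exact: fc.
  by apply/funext => n; rewrite pullback_prepend.
apply: cvg_state_unique.
by have := c1; rewrite -(cvg_shiftS (fun n => pullback f n (prepend (a, w)) point)).
Qed.

Lemma limit_stationary : stationary nu f (distribution P p).
Proof.
move=> A mA.
have mpA : measurable (p @^-1` A) by rewrite -[X in measurable X]setTI; exact: measurable_funP.
rewrite ge0_integral_distribution; last 2 first.
- exact: measurable_transition.
- by move=> y; rewrite transitionE.
have [N [mN N0 eN]] := limit_equivariant.
pose D := [set q : E * bisequence E | A (f q.1 (p q.2))].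
have mD : measurable D.
  apply: (measurable_step_set measurable_fst) => //.
  exact: (measurableT_comp (measurable_funP p) measurable_snd).
transitivity (P (p @^-1` A)); first by [].
rewrite (prepend_invariance hP mpA).
transitivity ((nu \x P) D).
  apply: (eq_measure_off_null _ mD mN N0).
    by rewrite -[X in measurable X]setTI; exact: measurable_prepend.
  by move=> [a w] Nw; rewrite /D /= eN.
transitivity (\int[nu]_a P [set w | D (a, w)]).
  by apply: eq_integral => a _ /=; rewrite xsection_set.
rewrite section_measure_swap//; apply: eq_integral => w _ /=.
by rewrite transitionE.
Qed.

(** The first letter read by the pullback acts last, so that conditioning on
    it reduces the claim for [A] to the claims for its preimages under the maps
    [f a], and stationarity puts these together again. *)
Lemma stationary_pullback (mu : probability (state S0) R) n A :
  stationary nu f mu -> measurable A ->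
  mu A = \int[mu]_x P [set w | A (pullback f n w x)].
Proof.
move=> smu; elim: n A => [|n IH] A mA.
  rewrite -[in LHS](setIT A) -integral_indic//; apply: eq_integral => x _ /=.
  rewrite indicE; case: (boolP (x \in A)) => /= xA.
    rewrite (_ : mkset _ = setT) ?probability_setT//.
    by apply/seteqP; split=> // w _; exact: set_mem.
  rewrite (_ : mkset _ = set0) ?measure0//.
  by apply/seteqP; split=> // w /= /mem_set Ax; rewrite Ax in xA.
have mD : measurable [set q : (state S0 * E) * bisequence E | A (f q.1.2 (pullback f n q.2 q.1.1))].
  apply: measurable_step_set => //.
    exact: (measurableT_comp measurable_snd measurable_fst).
  apply: (measurableT_comp (measurable_pullback2 mf n)
    (g := fun q : (state S0 * E) * bisequence E => (q.2, q.1.1))).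
  apply: measurable_fun_pair => //.
  exact: (measurableT_comp measurable_fst measurable_fst).
transitivity (\int[mu]_x \int[nu]_a P [set w | A (f a (pullback f n w x))]); last first.
  apply: eq_integral => x _.
  have mH : measurable [set w | A (pullback f n.+1 w x)].
    by rewrite -[X in measurable X]setTI; exact: measurable_pullback.
  rewrite (prob_prepend hP mH); apply: eq_integral => a _ /=; congr (P _).
  by apply/seteqP; split=> w /=; rewrite pullback_prepend.
rewrite (fubini_tonelli (fun q : state S0 * E => P [set w | A (f q.2 (pullback f n w q.1))]))//=;
  last exact: (measurable_fun_section_measure P mD).
transitivity (\int[nu]_a mu [set x | A (f a x)]); last first.
  apply: eq_integral => a _; rewrite IH//.
  exact: measurable_step_set.
have mD1 : measurable [set q : E * state S0 | A (f q.1 q.2)].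
  exact: (measurable_step_set measurable_fst measurable_snd).
apply: (etrans _ (esym (section_measure_swap nu mu mD1))).
by rewrite smu//; apply: eq_integral => x _; rewrite transitionE.
Qed.

(** Where [p w] is in [U], the convergent iterates eventually are; and the
    event [W N] that they are in [U] from time [N] on has probability at most
    the one that they are at time [N], which is [mu U]. *)
Lemma limit_open_le (mu : probability (state S0) R) U : stationary nu f mu -> open U ->
  distribution P p U <= mu U.
Proof.
move=> smu oU; have mU : measurable U by exact: open_state_measurable.
pose D n := [set q : state S0 * bisequence E | U (pullback f n q.2 q.1)].
have mD n : measurable (D n).
  rewrite -[X in measurable X]setTI.
  apply: (measurableT_comp (measurable_pullback2 mf n)
    (g := fun q : state S0 * bisequence E => (q.2, q.1))) => //.
  exact: measurable_fun_pair.
pose W N := \bigcap_n D (N + n)%N.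
have mW N : measurable (W N) by exact: bigcapT_measurable.
have mbW : measurable (\bigcup_N W N) by exact: bigcupT_measurable.
have W_le N : (mu \x P) (W N) <= mu U.
  rewrite (stationary_pullback N smu mU).
  rewrite [leRHS](_ : _ = (mu \x P) (D N)); last first.
    by apply: eq_integral => x _ /=; rewrite xsection_set.
  by apply: le_measure; rewrite ?inE// => q /(_ 0%N I); rewrite addn0.
have ndW : nondecreasing_seq W.
  move=> m n mn; apply/subsetPset => q Wq j _.
  by have := Wq (n - m + j)%N I; rewrite addnA subnKC.
have : (mu \x P) (\bigcup_N W N) <= mu U.
  have := nondecreasing_cvg_mu (mu := (mu \x P)%E) mW mbW ndW.
  move=> /(cvge_to_le); apply; apply: nearW => N; exact: W_le.
apply: le_trans.
have -> : distribution P p U = \int[mu]_x (distribution P p U).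
  by rewrite integral_cst// [X in _ * X]probability_setT mule1.
apply: ge0_le_integral => //.
- exact: measurable_fun_xsection.
move=> x _ /=; rewrite xsection_set.
have [N [mN N0 sN]] := plim x.
have mpU : measurable (p @^-1` U) by rewrite -[X in measurable X]setTI; exact: measurable_funP.
have mX : measurable [set w | (\bigcup_N W N) (x, w)].
  by rewrite -xsection_set; exact: measurable_xsection.
rewrite -(measureU0 mX mN N0).
suff : P (p @^-1` U) <= P ([set w | (\bigcup_N W N) (x, w)] `|` N) by [].
apply: le_measure; rewrite ?inE//; first exact: measurableU.
move=> w /= Uw; have [Nw|Nw] := pselect (N w); first by right.
left; have wp : pullback f n w x @[n --> \oo] --> p w.
  by apply: contrapT => h; apply: Nw; exact: sN.
have [M _ MU] := wp U (open_nbhs_nbhs (conj oU Uw)).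
by exists M => // n _; apply: MU; exact: leq_addr.
Qed.

Lemma limit_unique (mu : probability (state S0) R) : stationary nu f mu ->
  forall A, measurable A -> mu A = distribution P p A.
Proof.
move=> smu; apply: (measure_unique (@open (state S0)) (fun=> setT)) => //.
- exact: openI.
- by move=> _; exact: openT.
- by rewrite bigcup_const//; exists 0%N.
- move=> U oU; apply/eqP; rewrite eq_le limit_open_le// andbT.
  have [C [cC ndC CU _]] := open_state_exhaustion oU.
  have mU : measurable U by exact: open_state_measurable.
  have mC n : measurable (C n).
    by rewrite -[C n]setCK; apply: measurableC; apply: open_state_measurable; exact: closed_openC.
  have : (mu \o C) n @[n --> \oo] --> mu U.
    rewrite -[in X in _ --> X]CU; apply: nondecreasing_cvg_mu => //; exact: bigcupT_measurable.
  move=> /(cvge_to_le); apply; apply: nearW => n /=.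
  apply: (@le_trans _ _ (distribution P p (C n))).
    (* The inequality for the open complement of [C n], read on [C n]. *)
    have oC : open (~` C n) by exact: closed_openC.
    have := limit_open_le smu oC; rewrite [leRHS]probability_setC//.
    have -> : distribution P p (~` C n) = 1 - distribution P p (C n).
      exact: probability_setC.
    have f1 : mu (C n) \is a fin_num by exact: fin_num_measure.
    have f2 : distribution P p (C n) \is a fin_num by exact: fin_num_measure.
    by rewrite -(fineK f1) -(fineK f2) -!EFinB !lee_fin lerD2l lerN2.
  apply: le_measure; rewrite ?inE//; rewrite -CU => x Cx; by exists n.
- move=> _; exact: fin_num_fun_lty (fin_num_measure mu).
Qed.

End stationarity.

Theorem corollary1 (R : realType) (d : measure_display) (E : measurableType d)
    (nu : probability E R) (P : probability (bisequence E) R)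
    (k : nat) (J : {set 'I_k}) (S : set 'rV[R]_k) (S0 : S !=set0)
    (f : E -> state S0 -> state S0) :
  is_product_measure nu P ->
  connected S -> closed S ->
  measurable_fun setT (fun p : E * state S0 => f p.1 p.2) ->
  (forall a, continuous (f a)) ->
  (forall a, J_monotone J (f a)) ->
  J_splitting nu J f ->
  exists pi : {mfun bisequence E >-> state S0},
    [/\ forall x : state S0,
          {ae P, forall w,
            euclid_dist (coords (rand_iter f n (iter n bishift_inv w) x)) (coords (pi w))
              @[n --> \oo] --> (0 : R)},
        stationary nu f (distribution P pi)
      & forall mu : probability (state S0) R, stationary nu f mu ->
          forall A, measurable A -> mu A = distribution P pi A].
Proof.
move=> hP _ cS mf fc fJ splitting.
have [p plim] := pullback_limit hP cS mf fJ splitting.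
exists p; split.
- by move=> x; apply: filterS (plim x) => w; exact: euclid_dist_cvg0.
- exact: (limit_stationary hP mf fc plim).
- by move=> mu smu; exact: (limit_unique hP mf plim smu).
Qed.
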